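(* Let $$P=\begin{bmatrix}0&P_{12}\\P_{21}&0\end{bmatrix}$$ be an irreducible stochastic matrix, where $P_{12}$ and $P_{21}$ have size $n_1\times n_2$ and $n_2\times n_1$, respectively, and let $P_1=P_{12}P_{21}$ and $P_2=P_{21}P_{12}$. Let $E$ be a real matrix of the same size as $P$ with $E\mathbf{1}=0$ and $\|E\|_\infty\le1$. Set $P(\epsilon)=P+\epsilon E$ and assume that $P(\epsilon)$ is stochastic for all sufficiently small $\epsilon>0$. Then for any vector $\mathbf{h}$ with $\mathbf{h}^T\mathbf{1}=1$, as $\epsilon\to0^+$, $$\left|\kappa(P(\epsilon))-\kappa(P_1)-\kappa(P_2)-\frac12\right|\le\epsilon\,\|(I-P+\mathbf{1}\mathbf{h}^T)^{-2}\|_F\,\|E\|_F+O(\epsilon^2).$$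
   Context: A square nonnegative matrix $P$ is stochastic if $P\mathbf{1}=\mathbf{1}$, where $\mathbf{1}$ is the all-ones vector of appropriate size. $\|\cdot\|_\infty$ is the matrix norm induced by the vector infinity norm (maximum absolute row sum) and $\|\cdot\|_F$ the Frobenius norm. $P_1$ and $P_2$ are the stochastic complements of the two zero diagonal blocks in $P$; they are stochastic and irreducible. The $O(\epsilon^2)$ means: there are $C,\epsilon_0>0$ (depending on $P,E,\mathbf{h}$) such that the inequality holds with $C\epsilon^2$ in place of $O(\epsilon^2)$ for $0<\epsilon<\epsilon_0$. For small $\epsilon>0$, $P(\epsilon)$ is irreducible because $P$ is. Kemeny's constant of an irreducible stochastic $N\times N$ matrix $Q$ with eigenvalues $\lambda_1=1,\lambda_2,\dots,\lambda_N$ (with algebraic multiplicity) is $\kappa(Q)=\sum_{i=2}^N\frac{1}{1-\lambda_i}$; equivalently $\kappa(Q)=\operatorname{Tr}\big((I-Q+\mathbf{1}\mathbf{h}^T)^{-1}\big)-1$ for any $\mathbf{h}$ with $\mathbf{h}^T\mathbf{1}=1$. *)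

(* Defs.v *)
From HB Require Import structures.
From mathcomp Require Import all_boot all_order all_algebra.
From mathcomp Require Import reals complex.

Set Implicit Arguments.
Unset Strict Implicit.
Unset Printing Implicit Defensive.

Import Order.TTheory GRing.Theory Num.Theory.
Local Open Scope ring_scope.

Section Defs.
Variable R : realType.

Definition stochastic n (A : 'M[R]_n) : Prop :=
  (forall i j, 0 <= A i j) /\ A *m const_mx 1 = const_mx 1 :> 'cV[R]_n.

(* For a nonnegative matrix: the digraph with an arc i -> j whenever
   0 < A i j is strongly connected. *)
Definition irreducible_mx n (A : 'M[R]_n) : Prop :=
  forall i j : 'I_n, connect [rel k l | 0 < A k l] i j.

(* Maximum absolute row sum. *)
Definition norm_inf m n (A : 'M[R]_(m, n)) : R :=
  \big[Num.max/0]_i \sum_j `|A i j|.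

Definition norm_fro m n (A : 'M[R]_(m, n)) : R :=
  Num.sqrt (\sum_i \sum_j `|A i j| ^+ 2).

(* The complex eigenvalues of a real matrix, listed with algebraic
   multiplicity (in an unspecified order). *)
Definition eigenvalues n (A : 'M[R]_n) : seq R[i] :=
  sval (closed_field_poly_normal (char_poly (map_mx (real_complex R) A))).

(* [rem] deletes a single occurrence of the eigenvalue 1. For an irreducible
   stochastic matrix 1 is a simple eigenvalue, so no denominator vanishes.
   The value is kept complex, since the eigenvalues are. *)
Definition kemeny n (A : 'M[R]_n) : R[i] :=
  \sum_(l <- rem 1 (eigenvalues A)) (1 - l)^-1.

End Defs.

(* Main.v *)
Require Import Defs.
From HB Require Import structures.
From mathcomp Require Import all_boot all_order all_algebra.
From mathcomp Require Import reals complex.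
From mathcomp Require Import ring lra.

Set Implicit Arguments.
Unset Strict Implicit.
Unset Printing Implicit Defensive.

Import Order.TTheory GRing.Theory Num.Theory.
Local Open Scope ring_scope.

(** If [char_poly Q = ('X - 1) * q] with [q.[1] != 0], Kemeny's constant of [Q]
    is the logarithmic derivative of [q] at 1. For an antidiagonal block matrix
    [P], Schur complements give
    [chi_P(X) X^n1 = chi_P1(X^2) X^n2] and [chi_P(X) X^n2 = chi_P2(X^2) X^n1];
    since [X^2 - 1 = (X - 1)(X + 1)], the sum of the two logarithmic derivatives
    at 1 is twice the identity [kappa(P) = kappa(P1) + kappa(P2) + 1/2].
    The perturbation is handled through
    [kappa(Q) = tr ((I - Q + 1 h^T)^-1) - 1], which comes from
    [(X - 1) chi_(Q - 1 h^T) = X chi_Q], and the second-order resolvent expansion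
    of the inverse, whose first-order term has trace
    [eps tr (Z E Z) = eps tr (Z^2 E)], bounded by Cauchy-Schwarz. *)

(** * Schur complement determinants *)

(** Both sides come from the determinant [D] of one block matrix, by clearing [B] or [A].
    Multiplying by a block matrix of determinant [x ^+ n] avoids dividing by [x], so [x] may be an
    indeterminate. *)
Lemma det_scalar_sub_mulmxC (R : comNzRingType) m n (x : R)
    (A : 'M[R]_(m, n)) (B : 'M[R]_(n, m)) :
  \det (x%:M - A *m B) * x ^+ n = x ^+ m * \det (x%:M - B *m A).
Proof.
pose D := \det (block_mx x%:M A B 1%:M).
have -> : \det (x%:M - A *m B) = D.
  transitivity (D * \det (block_mx 1%:M 0 (- B) 1%:M : 'M_(m + n))).
    rewrite -det_mulmx mulmx_block !mulmx0 !mulmx1 !mul1mx !add0r subrr.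
    by rewrite det_ublock det1 mulr1 mulmxN.
  by rewrite det_lblock !det1 !mulr1.
transitivity (D * \det (block_mx 1%:M (- A) 0 x%:M : 'M_(m + n))).
  by rewrite det_ublock det1 mul1r det_scalar.
rewrite -det_mulmx mulmx_block !mulmx0 !mulmx1 !mul1mx !addr0 !mulmxN.
by rewrite scalar_mxC addNr det_lblock det_scalar addrC.
Qed.

Lemma det_scalar_sub_antidiag_l (R : comNzRingType) m n (x : R)
    (A : 'M[R]_(m, n)) (B : 'M[R]_(n, m)) :
  \det (x%:M - block_mx 0 A B 0) * x ^+ m = \det ((x ^+ 2)%:M - A *m B) * x ^+ n.
Proof.
transitivity (\det (x%:M - block_mx 0 A B 0)
              * \det (block_mx x%:M 0 B 1%:M : 'M_(m + n))).
  by rewrite det_lblock det1 mulr1 det_scalar.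
rewrite -det_mulmx scalar_mx_block opp_block_mx add_block_mx mulmx_block.
rewrite !oppr0 !addr0 !add0r !mulmx0 !add0r !mulmx1 -scalar_mxM !mulNmx.
by rewrite -scalar_mxC addNr det_ublock det_scalar expr2.
Qed.

Lemma det_scalar_sub_antidiag_r (R : comNzRingType) m n (x : R)
    (A : 'M[R]_(m, n)) (B : 'M[R]_(n, m)) :
  \det (x%:M - block_mx 0 A B 0) * x ^+ n = x ^+ m * \det ((x ^+ 2)%:M - B *m A).
Proof.
transitivity (\det (x%:M - block_mx 0 A B 0)
              * \det (block_mx 1%:M A 0 x%:M : 'M_(m + n))).
  by rewrite det_ublock det1 mul1r det_scalar.
rewrite -det_mulmx scalar_mx_block opp_block_mx add_block_mx mulmx_block.
rewrite !oppr0 !addr0 !add0r !mulmx0 !addr0 !mulmx1 -scalar_mxM !mulNmx.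
by rewrite -scalar_mxC subrr det_lblock det_scalar expr2 [- _ + _]addrC.
Qed.

(** * Characteristic polynomials of antidiagonal and deflated matrices *)

Lemma char_poly_comp (R : comNzRingType) n (A : 'M[R]_n) (p : {poly R}) :
  char_poly A \Po p = \det (p%:M - map_mx polyC A).
Proof.
rewrite /char_poly -[_ \Po _]/(comp_poly p _) -det_map_mx; congr (\det _).
by apply/matrixP => i j; rewrite !mxE raddfB raddfMn /= comp_polyX comp_polyC.
Qed.

Lemma char_polyE (R : comNzRingType) n (A : 'M[R]_n) :
  char_poly A = \det ('X%:M - map_mx polyC A).
Proof. by []. Qed.

Lemma char_poly_antidiag_l (R : comNzRingType) m n
    (A : 'M[R]_(m, n)) (B : 'M[R]_(n, m)) :
  char_poly (block_mx 0 A B 0) * 'X^m = (char_poly (A *m B) \Po 'X^2) * 'X^n.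
Proof.
by rewrite char_poly_comp char_polyE map_block_mx !raddf0 map_mxM
  det_scalar_sub_antidiag_l.
Qed.

Lemma char_poly_antidiag_r (R : comNzRingType) m n
    (A : 'M[R]_(m, n)) (B : 'M[R]_(n, m)) :
  char_poly (block_mx 0 A B 0) * 'X^n = (char_poly (B *m A) \Po 'X^2) * 'X^m.
Proof.
by rewrite char_poly_comp char_polyE map_block_mx !raddf0 map_mxM
  det_scalar_sub_antidiag_r mulrC.
Qed.

(** Deflation: the rank-one term moves one eigenvalue 1 of [Q] to 0 and leaves the rest of the
    spectrum in place. *)
Lemma char_poly_deflate (R : idomainType) n (Q : 'M[R]_n) (h : 'cV[R]_n) :
  Q *m const_mx 1 = const_mx 1 :> 'cV_n -> h^T *m const_mx 1 = 1%:M :> 'M_1 ->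
  ('X - 1) * char_poly (Q - const_mx 1 *m h^T) = 'X * char_poly Q.
Proof.
move=> Q1 h1; pose y : {poly R} := 'X - 1.
pose u : 'cV[{poly R}]_n := const_mx 1; pose v := map_mx polyC h^T.
pose QX := map_mx polyC Q.
have Eu : map_mx polyC (const_mx 1 : 'cV[R]_n) = u.
  by apply/matrixP => i j; rewrite !mxE.
have Qu : QX *m u = u by rewrite -Eu -map_mxM Q1.
have vu : v *m u = 1%:M by rewrite -Eu -map_mxM h1 map_scalar_mx.
have y0 : y != 0 by rewrite -size_poly_eq0 size_XsubC.
(* (X - Q)(y + u v) = y (X - Q + u v), as (X - Q) u = y u *)
have key : ('X%:M - QX) *m (y%:M - (- u) *m v) = y *: ('X%:M - QX + u *m v).
  rewrite mulNmx opprK mulmxDr mul_mx_scalar mulmxA mulmxBl mul_scalar_mx Qu.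
  by rewrite -[in 'X *: u - u](scale1r u) scalerA mulr1 -scalerBl -scalemxAl -scalerDr.
have := congr1 determinant key; rewrite det_mulmx detZ.
(* Swapping the rank-one factors leaves a 1 by 1 determinant, [y + 1 = 'X]. *)
have := det_scalar_sub_mulmxC y (- u) v.
rewrite expr1 mulmxN vu opprK det_mx11 !mxE eqxx !mulr1n => dy.
rewrite -char_polyE.
have -> : \det ('X%:M - QX + u *m v) = char_poly (Q - const_mx 1 *m h^T).
  by rewrite char_polyE map_mxB map_mxM Eu opprB addrA addrAC.
move=> /(congr1 ( *%R^~ y)); rewrite -mulrA dy.
have -> : y + 1 = 'X by rewrite /y subrK.
move=> e; apply: (mulfI (expf_neq0 n y0)).
by rewrite mulrA mulrAC -e; ring.
Qed.

(** * Kemeny's constant as a logarithmic derivative *)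

Lemma eigenvaluesP (R : realType) n (A : 'M[R]_n) :
  char_poly (map_mx (real_complex R) A) = \prod_(z <- eigenvalues A) ('X - z%:P).
Proof.
rewrite /eigenvalues; case: closed_field_poly_normal => s /= {1}->.
by rewrite (monicP (char_poly_monic _)) scale1r.
Qed.

Lemma horner_logderiv_prod_XsubC (F : fieldType) (s : seq F) (x : F) :
  (\prod_(z <- s) ('X - z%:P)).[x] != 0 ->
  \sum_(z <- s) (x - z)^-1 =
    (\prod_(z <- s) ('X - z%:P))^`().[x] / (\prod_(z <- s) ('X - z%:P)).[x].
Proof.
elim: s => [|z s IHs]; first by rewrite !big_nil derivC horner0 mul0r.
rewrite !big_cons !derivE !hornerE mulf_eq0 => /norP[zx sx].
by rewrite (IHs sx); field; rewrite zx sx.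
Qed.

(** Over [R[i]], deleting one eigenvalue 1 leaves exactly the roots of [q]. *)
Lemma kemeny_logderiv (R : realType) n (A : 'M[R]_n) (q : {poly R}) :
  char_poly A = ('X - 1) * q -> q.[1] != 0 ->
  kemeny A = real_complex R (q^`().[1] / q.[1]).
Proof.
move=> Aq q1; set c := real_complex R.
have Es : \prod_(z <- eigenvalues A) ('X - z%:P) = ('X - 1) * map_poly c q.
  by rewrite -eigenvaluesP -map_char_poly Aq rmorphM rmorphB /= map_polyX rmorph1.
have s1 : 1 \in eigenvalues A.
  by rewrite -root_prod_XsubC Es rootE !hornerE subrr mul0r.
have X1 : 'X - 1 != 0 :> {poly R[i]} by rewrite -size_poly_eq0 size_XsubC.
move: Es; rewrite (perm_big _ (perm_to_rem s1)) big_cons => /(mulfI X1) Es.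
have ev (p : {poly R}) : (map_poly c p).[1] = c p.[1].
  by rewrite -(rmorph1 (real_complex R)) horner_map.
rewrite /kemeny horner_logderiv_prod_XsubC Es ?deriv_map ?ev.
  by rewrite /c fmorph_div.
by rewrite fmorph_eq0.
Qed.

Lemma kemeny_antidiag (R : realType) m n (A : 'M[R]_(m, n)) (B : 'M[R]_(n, m))
    (q : {poly R}) :
  char_poly (block_mx 0 A B 0) = ('X - 1) * q -> q.[1] != 0 ->
  kemeny (block_mx 0 A B 0) = kemeny (A *m B) + kemeny (B *m A) + 2^-1.
Proof.
move=> Eq q1; rewrite (kemeny_logderiv Eq q1).
(* With [r] the cofactor of ['X - 1] in [char_poly D], cancelling ['X - 1] gives [q * 'X^k = ('X +
   1) * (r \Po 'X^2) * 'X^l]. Logarithmic derivatives at 1 then read q'/q + k = 1/2 + 2 r'/r + l. *)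
have half (k l : nat) (D : 'M[R]_k) :
    ('X - 1) * q * 'X^k = (char_poly D \Po 'X^2) * 'X^l ->
    kemeny D = real_complex R ((q^`().[1] / q.[1] + k%:R - l%:R - 2^-1) / 2).
  move=> EX; have D1 : root (char_poly D) 1.
    have /(congr1 (horner^~ 1)) := EX.
    rewrite !hornerE horner_comp !hornerE !expr1n subrr !mul0r mulr1.
    by rewrite rootE => <-.
  have [r Er] := factor_theorem _ _ D1; rewrite mulrC in Er.
  have X1 : 'X - 1 != 0 :> {poly R} by rewrite -size_poly_eq0 size_XsubC.
  have {}EX : q * 'X^k = ('X + 1) * (r \Po 'X^2) * 'X^l.
    apply: (mulfI X1); rewrite mulrA EX Er rmorphM rmorphB /= comp_polyX rmorph1.
    by ring.
  have e0 : q.[1] = 2 * r.[1].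
    have /(congr1 (horner^~ 1)) := EX.
    by rewrite !hornerE horner_comp !hornerE !expr1n !mulr1.
  have /(congr1 (fun p => p^`().[1])) := EX.
  rewrite !(derivM, derivD, derivXn, derivX, derivC, deriv_comp) -?polyC1.
  rewrite !(hornerE, horner_comp, hornerMn) !expr1n e0 => e1.
  have r1 : r.[1] != 0 by apply: contra q1 => /eqP r1; rewrite e0 r1 mulr0.
  rewrite (kemeny_logderiv Er r1); congr (real_complex R _).
  have -> : q^`().[1] = r.[1] + 4 * r^`().[1] + 2 * r.[1] * l%:R - 2 * r.[1] * k%:R.
    apply/eqP; rewrite eq_sym subr_eq; apply/eqP.
    by rewrite -[q^`().[1]]mulr1 e1 /=; ring.
  by field.
(* The shifts [m - n] and [n - m] cancel; each half contributes -1/4. *)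
rewrite (half m n) -?Eq ?char_poly_antidiag_l // (half n m) -?Eq ?char_poly_antidiag_r //.
rewrite -(rmorph_nat (real_complex R) 2) -fmorphV -!rmorphD; congr (real_complex R _).
by field.
Qed.

(** * Trace formula for Kemeny's constant *)

Lemma char_poly_conj (F : fieldType) n (P A : 'M[F]_n) :
  P \in unitmx -> char_poly (P *m A *m invmx P) = char_poly A.
Proof.
move=> uP; have := det_scalar_sub_mulmxC 'X (map_mx polyC (P *m A))
  (map_mx polyC (invmx P)).
rewrite -!map_mxM mulmxA mulVmx // mul1mx mulrC.
by apply: mulfI; rewrite expf_neq0 ?polyX_eq0.
Qed.

Lemma mxtrace_conj (F : fieldType) n (P A : 'M[F]_n) :
  P \in unitmx -> \tr (P *m A *m invmx P) = \tr A.
Proof. by move=> uP; rewrite mxtrace_mulC mulmxA mulVmx // mul1mx. Qed.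

Lemma trig_mulmx_diag (R : pzRingType) n (A B : 'M[R]_n) i :
  is_trig_mx A -> is_trig_mx B -> (A *m B) i i = A i i * B i i.
Proof.
move=> /is_trig_mxP tA /is_trig_mxP tB; rewrite mxE (bigD1 i) //= big1 ?addr0 //.
move=> k nki; case: (ltngtP i k) => [ik|ki|/val_inj ik].
- by rewrite tA ?mul0r.
- by rewrite tB ?mulr0.
- by rewrite ik eqxx in nki.
Qed.

(* M and its resolvent commute, so they are trigonalized by the same P. *)
Lemma mxtrace_resolvent (C : numClosedFieldType) n (M : 'M[C]_n) (s : seq C) (x : C) :
  char_poly M = \prod_(z <- s) ('X - z%:P) -> x%:M - M \in unitmx ->
  \tr (invmx (x%:M - M)) = \sum_(z <- s) (x - z)^-1.
Proof.
move=> Ms uM; set Z := invmx _.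
have comMZ : M *m Z = Z *m M.
  have : (x%:M - M) *m Z = Z *m (x%:M - M) by rewrite mulmxV // mulVmx.
  by rewrite mulmxBl mulmxBr scalar_mxC => /addrI /oppr_inj.
have [P /unitarymx_unit uP /andP[]] := cotrigonalization2 comMZ.
rewrite /similar_to /= !conjumx // => tM tZ.
rewrite -(mxtrace_conj Z uP) -(char_poly_conj M uP) (char_poly_trig tM) in Ms *.
(* The diagonal of the triangularized [M] lists its eigenvalues. *)
have ps : perm_eq [seq (P *m M *m invmx P) i i | i : 'I_n] s.
  by apply: prod_XsubC_eq; rewrite -Ms big_image.
rewrite -(perm_big _ ps) big_image /=; apply: eq_bigr => i _.
have /(congr1 (fun A : 'M_n => A i i)) :
    (x%:M - P *m M *m invmx P) *m (P *m Z *m invmx P) = 1%:M.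
  have -> : x%:M - P *m M *m invmx P = P *m (x%:M - M) *m invmx P.
    by rewrite mulmxBr mulmxBl scalar_mxC -[_%:M *m _ *m _]mulmxA mulmxV // mulmx1.
  by rewrite !mulmxA mulmxKV // -(mulmxA P) mulmxV // mulmx1 mulmxV.
rewrite trig_mulmx_diag //; first last.
  apply/is_trig_mxP => k l kl; rewrite mxE [X in _ + X]mxE (is_trig_mxP tM) //.
  by rewrite mxE -val_eqE ltn_eqF // subr0.
rewrite [in RHS]mxE eqxx mulr1n !mxE eqxx mulr1n => e.
rewrite -[RHS]mulr1 -e mulKf //.
by apply: contra_eq_neq e => ->; rewrite mul0r eq_sym oner_neq0.
Qed.

Lemma root_char_poly_row_sum (F : fieldType) n (Q : 'M[F]_n) (h : 'cV[F]_n) :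
  Q *m const_mx 1 = const_mx 1 :> 'cV_n -> h^T *m const_mx 1 = 1%:M :> 'M_1 ->
  root (char_poly Q) 1.
Proof.
move=> Q1 h1; have /(congr1 (horner^~ 1)) := char_poly_deflate Q1 h1.
by rewrite !hornerE subrr mul0r rootE => <-.
Qed.

(** Deflation gives [char_poly (Q - const_mx 1 *m h^T) = 'X * q], evaluated here at 1. Invertibility
    of the fundamental matrix thus yields [q.[1] != 0]. *)
Lemma horner1_deflated (F : fieldType) n (Q : 'M[F]_n) (h : 'cV[F]_n) (q : {poly F}) :
  Q *m const_mx 1 = const_mx 1 :> 'cV_n -> h^T *m const_mx 1 = 1%:M :> 'M_1 ->
  char_poly Q = ('X - 1) * q -> q.[1] = \det (1%:M - Q + const_mx 1 *m h^T).
Proof.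
move=> Q1 h1 Eq; have := char_poly_deflate Q1 h1; rewrite Eq mulrCA.
move=> /(mulfI _); rewrite -size_poly_eq0 size_XsubC => /(_ isT).
move=> /(congr1 (horner^~ 1)); rewrite hornerM hornerX mul1r => <-.
rewrite -[LHS]/(horner_eval 1 _) -det_map_mx; congr (\det _); apply/matrixP => i j.
by rewrite !mxE /= /horner_eval !hornerE hornerMn !hornerE opprB addrA addrAC.
Qed.

Lemma kemeny_mxtrace (R : realType) n (Q : 'M[R]_n) (h : 'cV[R]_n) :
  Q *m const_mx 1 = const_mx 1 :> 'cV_n -> h^T *m const_mx 1 = 1%:M :> 'M_1 ->
  1%:M - Q + const_mx 1 *m h^T \in unitmx ->
  kemeny Q = real_complex R (\tr (invmx (1%:M - Q + const_mx 1 *m h^T)) - 1).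
Proof.
move=> Q1 h1 uA; pose c := real_complex R.
have e1 : map_mx c (const_mx 1) = const_mx 1 :> 'cV_n.
  by apply/matrixP => i j; rewrite !mxE.
have cQ1 : map_mx c Q *m const_mx 1 = const_mx 1 :> 'cV_n by rewrite -e1 -map_mxM Q1.
have ch1 : (map_mx c h)^T *m const_mx 1 = 1%:M :> 'M_1.
  by rewrite -e1 map_trmx -map_mxM h1 map_mx1.
have s1 : 1 \in eigenvalues Q.
  by rewrite -root_prod_XsubC -eigenvaluesP (root_char_poly_row_sum cQ1 ch1).
have := char_poly_deflate cQ1 ch1.
rewrite eigenvaluesP (perm_big _ (perm_to_rem s1)) big_cons mulrCA.
move=> /(mulfI _); rewrite -size_poly_eq0 size_XsubC => /(_ isT).
set M := _ - _ => Ms.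
(* The head 0 is the deflated eigenvalue 1; its term 1/(1 - 0) accounts for the [- 1] in the
   formula. *)
have {}Ms : char_poly M = \prod_(z <- 0 :: rem 1 (eigenvalues Q)) ('X - z%:P).
  by rewrite big_cons subr0.
have EM : map_mx c (1%:M - Q + const_mx 1 *m h^T) = 1%:M - M.
  by rewrite map_mxD map_mxB map_mx1 map_mxM e1 -map_trmx opprB addrA addrAC.
rewrite rmorphB rmorph1 /= -trace_map_mx map_invmx EM (mxtrace_resolvent Ms).
  by rewrite big_cons subr0 invr1 addrC addKr.
by rewrite -EM map_unitmx.
Qed.

(** * Invertibility of the fundamental matrix *)

Lemma stochastic_rowsum (R : realType) n (P : 'M[R]_n) k :
  stochastic P -> \sum_l P k l = 1.
Proof.
move=> [_ /matrixP/(_ k 0)]; rewrite !mxE => <-.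
by apply: eq_bigr => l _; rewrite mxE mulr1.
Qed.

(* At a maximum k of v, row k of the equation reads
   \sum_l P k l (v k - v l) = - c with nonnegative terms. *)
Lemma stochastic_shift_le0 (R : realType) n (P : 'M[R]_n) (v : 'cV[R]_n) c k :
  stochastic P -> P *m v = v + const_mx c -> (forall l, v l 0 <= v k 0) ->
  c <= 0 /\ (c = 0 -> forall l, 0 < P k l -> v l 0 = v k 0).
Proof.
move=> sP /matrixP/(_ k 0); rewrite !mxE => Pv vk.
have Pge0 : forall k l, 0 <= P k l by case: sP.
have terms l : true -> 0 <= P k l * (v k 0 - v l 0).
  by rewrite mulr_ge0 // subr_ge0.
have sumE : \sum_l P k l * (v k 0 - v l 0) = - c.
  under eq_bigr do rewrite mulrBr.
  by rewrite sumrB -mulr_suml stochastic_rowsum // mul1r Pv opprD addrA subrr add0r.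
split; first by rewrite -oppr_ge0 -sumE sumr_ge0.
move=> c0 l Pkl; move: sumE; rewrite c0 oppr0 => /(psumr_eq0P terms)/(_ l isT)/eqP.
by rewrite mulf_eq0 gt_eqF //= subr_eq0 => /eqP.
Qed.

(** A kernel vector [v] satisfies P v = v + c 1 with c = h^T v. The maximum principle for [v] and
    [- v] forces c = 0, irreducibility then makes [v] constant, and h^T v = 0 makes the constant
    0. *)
Lemma unitmx_fundamental (R : realType) n (P : 'M[R]_n) (h : 'cV[R]_n) :
  stochastic P -> irreducible_mx P -> h^T *m const_mx 1 = 1%:M :> 'M_1 ->
  1%:M - P + const_mx 1 *m h^T \in unitmx.
Proof.
move=> sP iP h1; rewrite -unitmx_tr unitmxE unitfE; apply/det0P => -[w w0 wA].
pose v := w^T; pose c := (h^T *m v) 0 0.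
have hv : h^T *m v = c%:M by rewrite [LHS]mx11_scalar.
have Pv : P *m v = v + const_mx c.
  have : (1%:M - P + const_mx 1 *m h^T) *m v = 0.
    by apply: trmx_inj; rewrite trmx_mul trmxK wA trmx0.
  rewrite mulmxDl mulmxBl mul1mx -mulmxA hv mul_mx_scalar => /eqP.
  rewrite addrAC subr_eq0 => /eqP <-; congr (_ + _).
  by apply/matrixP => i j; rewrite !mxE mulr1.
have [i0 _] : exists i0, w 0 i0 != 0 by move/rV0Pn: w0.
have [k _ kmax] := @arg_maxP _ _ _ i0 predT (fun i => v i 0) isT.
have [m _ mmax] := @arg_maxP _ _ _ i0 predT (fun i => (- v) i 0) isT.
have [cle0 ceq0] := stochastic_shift_le0 sP Pv (fun l => kmax l isT).
have Pv' : P *m (- v) = - v + const_mx (- c).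
  by rewrite mulmxN Pv opprD; congr (_ + _); apply/matrixP => i j; rewrite !mxE.
have [cge0 _] := stochastic_shift_le0 sP Pv' (fun l => mmax l isT).
have c0 : c = 0 by apply/eqP; rewrite eq_le cle0 -oppr_le0 cge0.
have vconst l : v l 0 = v k 0.
  have /connectP[p] := iP k l.
  (* A vertex where [v] is maximal passes its value to its out-neighbours, so the induction follows
     the path. *)
  suff H i : v i 0 = v k 0 -> path [rel k l | 0 < P k l] i p ->
      l = last i p -> v l 0 = v k 0 by apply: H.
  elim: p i => [|j p IHp] i /= vi; first by move=> _ ->.
  move=> /andP[Pij pth] el; apply: (IHp j) => //.
  have imax l' : v l' 0 <= v i 0 by rewrite vi; exact: kmax.
  by have [_ /(_ c0 j Pij) ->] := stochastic_shift_le0 sP Pv imax.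
have vE : v = v k 0 *: const_mx 1.
  by apply/matrixP => i j; rewrite ord1 [RHS]mxE [X in _ * X]mxE mulr1; exact: vconst.
have vk0 : v k 0 = 0.
  have : h^T *m v = (v k 0)%:M by rewrite {1}vE -scalemxAr h1 scalemx1.
  by rewrite hv c0 => /matrixP/(_ 0 0); rewrite !mxE eqxx !mulr1n.
by case/eqP: w0; apply: trmx_inj; rewrite -/v vE vk0 scale0r trmx0.
Qed.

(** * Cauchy-Schwarz and the Frobenius norm *)

Lemma cauchy_schwarz_sum (R : rcfType) (I : finType) (a b : I -> R) :
  `|\sum_i a i * b i| <=
    Num.sqrt (\sum_i `|a i| ^+ 2) * Num.sqrt (\sum_i `|b i| ^+ 2).
Proof.
have sqE (f : I -> R) : \sum_i `|f i| ^+ 2 = \sum_i f i * f i.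
  by apply: eq_bigr => i _; rewrite real_normK ?num_real // expr2.
rewrite !sqE; set X := \sum_i a i * a i; set Y := \sum_i b i * b i.
set Z := \sum_i a i * b i.
have X0 : 0 <= X by rewrite /X -sqE sumr_ge0 // => i _; apply: exprn_ge0.
have Y0 : 0 <= Y by rewrite /Y -sqE sumr_ge0 // => i _; apply: exprn_ge0.
rewrite -sqrtrM // -sqrtr_sqr ler_sqrt ?mulr_ge0 //.
move: Y0; rewrite le0r => /orP[/eqP Y0|Y0].
  rewrite [Z]big1 ?expr0n ?mulr_ge0 ?Y0 // => i _.
  have /psumr_eq0P : forall i, true -> 0 <= b i * b i by move=> j _; rewrite -expr2 sqr_ge0.
  by move=> /(_ Y0 i isT)/eqP; rewrite mulf_eq0 orbb => /eqP ->; rewrite mulr0.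
rewrite -subr_ge0 -(pmulr_rge0 _ Y0).
(* Multiplying the defect by [Y > 0] makes it a sum of squares. *)
have -> : Y * (X * Y - Z ^+ 2) = \sum_i (Y * a i - Z * b i) ^+ 2.
  transitivity (Y ^+ 2 * X - 2 * Y * Z * Z + Z ^+ 2 * Y); first by ring.
  have distr k (f : I -> R) : k * (\sum_i f i) = \sum_i k * f i by rewrite mulr_sumr.
  rewrite (distr (Y ^+ 2)) (distr (2 * Y * Z)) (distr (Z ^+ 2)) -sumrB -big_split /=.
  by apply: eq_bigr => i _; ring.
by apply: sumr_ge0 => i _; apply: sqr_ge0.
Qed.

Lemma mxtrace_le_norm_fro (R : realType) n (A B : 'M[R]_n) :
  `|\tr (A *m B)| <= norm_fro A * norm_fro B.
Proof.
have -> : \tr (A *m B) = \sum_(p : 'I_n * 'I_n) A p.1 p.2 * B p.2 p.1.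
  by rewrite -(pair_bigA _ (fun i j => A i j * B j i)); apply: eq_bigr => i _; rewrite mxE.
rewrite /norm_fro [X in _ * Num.sqrt X]exchange_big !pair_bigA /=.
exact: cauchy_schwarz_sum.
Qed.

(** * Second-order expansion of the trace of the inverse *)

Lemma poly_away_from0 (R : realFieldType) (p : {poly R}) : p.[0] != 0 ->
  exists d K : R, [/\ 0 < d, 0 < K & forall x, `|x| < d -> K <= `|p.[x]|].
Proof.
elim/poly_ind: p => [|q c _]; rewrite ?horner0 ?eqxx // !hornerE => c0.
have [M qM] := poly_disk_bound q 1; have c_gt0 : 0 < `|c| by rewrite normr_gt0.
have M0 : 0 <= M by apply: le_trans (qM 0 _); rewrite ?normr0.
(* As [|q| <= M] on the unit disk, this radius keeps [|q.[x] * x|] below [|c| / 2]; [M + 1] guards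
   against [M = 0]. *)
exists (Num.min 1 (`|c| / (2 * (M + 1)))), (`|c| / 2); split.
- by rewrite lt_min ltr01 divr_gt0 // mulr_gt0 // ltr_wpDl.
- by rewrite divr_gt0.
move=> x; rewrite lt_min => /andP[/ltW x1]; rewrite ltr_pdivlMr => [xM|]; last lra.
have qx := qM x x1; rewrite !hornerE.
have : `|c| <= `|q.[x] * x + c| + `|q.[x] * x|.
  by rewrite -{1}[c](addrK (q.[x] * x)) [c + _]addrC ler_normB.
rewrite normrM.
have : `|q.[x]| * `|x| <= M * `|x| by rewrite ler_wpM2r.
have := normr_ge0 x; nra.
Qed.

(* The remainder is tr (Z E Z E (A - e E)^-1) e^2, and its coefficient is a
   quotient of two polynomials in e whose denominator does not vanish at 0. *)
Lemma mxtrace_invmx_perturb (R : realFieldType) n (A E : 'M[R]_n) :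
  A \in unitmx ->
  exists d C : R, [/\ 0 < d, 0 < C & forall e, 0 < e < d ->
    A - e *: E \in unitmx /\
    `|\tr (invmx (A - e *: E)) - \tr (invmx A) - e * \tr (invmx A *m E *m invmx A)|
      <= C * e ^+ 2].
Proof.
move=> uA; set Z := invmx A; set V := Z *m E *m Z *m E.
(* [B] is [A - e *: E] with [e] an indeterminate; [f] and [p] are the numerator and denominator of
   the remainder coefficient. *)
pose B := map_mx polyC A - 'X *: map_mx polyC E.
have evB e : map_mx (horner_eval e) B = A - e *: E.
  by apply/matrixP => i j; rewrite /B !mxE /horner_eval !hornerE.
pose p := \det B; pose f := \tr (map_mx polyC V *m \adj B).
have pE e : p.[e] = \det (A - e *: E).
  by rewrite -[LHS]/(horner_eval e p) -det_map_mx evB.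
have fE e : f.[e] = \tr (V *m \adj (A - e *: E)).
  rewrite -[LHS]/(horner_eval e f) -trace_map_mx map_mxM map_mx_adj evB; congr (\tr (_ *m _)).
  by apply/matrixP => i j; rewrite !mxE; apply: hornerC.
have p0 : p.[0] != 0 by rewrite pE scale0r subr0 -unitfE -unitmxE.
have [d [K [d0 K0 pK]]] := poly_away_from0 p0.
have [M fM] := poly_disk_bound f d.
have M0 : 0 <= M by apply: (le_trans (normr_ge0 f.[0])); apply: fM; rewrite normr0 ltW.
exists d, ((M + 1) / K); split=> // [|e /andP[e0 ed]].
  by rewrite divr_gt0 // ltr_wpDl.
have pe := pK e; rewrite gtr0_norm // in pe; have {}pe := pe ed.
have uW : A - e *: E \in unitmx.
  by rewrite unitmxE unitfE -pE -normr_gt0 (lt_le_trans K0).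
split=> //; set W := invmx _.
(* Resolvent identity; substituting it into itself once produces the second-order remainder. *)
have WE : W = Z + e *: (Z *m E *m W).
  rewrite scalemxAl scalemxAr -{1}(mulmx1 Z) -(mulmxV uW) -/W mulmxA -mulmxDl.
  by rewrite -mulmxDr subrK mulVmx // mul1mx.
have -> : \tr W - \tr Z - e * \tr (Z *m E *m Z) = e ^+ 2 * \tr (V *m W).
  rewrite {1}WE {1}WE mulmxDr -scalemxAr scalerDr scalerA -expr2 !mxtraceD !mxtraceZ.
  by rewrite !mulmxA -/V; ring.
(* Writing the inverse as adjugate over determinant turns the coefficient into [f.[e] / p.[e]]. *)
rewrite /W /invmx uW -scalemxAr mxtraceZ -fE -pE mulrA normrM normrM normfV.
have fe : `|f.[e]| <= M + 1.
  by apply: (le_trans (fM e _)); rewrite ?lerDl ?ler01 // gtr0_norm // ltW.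
rewrite gtr0_norm ?exprn_gt0 // -mulrA mulrC ler_wpM2r ?sqr_ge0 // [_^-1 * _]mulrC.
by rewrite ler_pM ?invr_ge0 // lef_pV2 // posrE (lt_le_trans K0).
Qed.

(** * The perturbation bound *)

Theorem corollary5p1 (R : realType) (n1 n2 : nat)
    (P12 : 'M[R]_(n1, n2)) (P21 : 'M[R]_(n2, n1))
    (E : 'M[R]_(n1 + n2)) (h : 'cV[R]_(n1 + n2)) :
  let P : 'M[R]_(n1 + n2) := block_mx 0 P12 P21 0 in
  let P1 : 'M[R]_n1 := P12 *m P21 in
  let P2 : 'M[R]_n2 := P21 *m P12 in
  let Z : 'M[R]_(n1 + n2) := invmx (1%:M - P + const_mx 1 *m h^T) in
  stochastic P ->
  irreducible_mx P ->
  E *m const_mx 1 = 0 :> 'cV[R]_(n1 + n2) ->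
  norm_inf E <= 1 ->
  (exists2 e1 : R, 0 < e1 &
     forall eps : R, 0 < eps < e1 -> stochastic (P + eps *: E)) ->
  h^T *m const_mx 1 = 1%:M :> 'M[R]_1 ->
  exists C eps0 : R, [/\ 0 < C, 0 < eps0 &
    forall eps : R, 0 < eps < eps0 ->
      `|kemeny (P + eps *: E) - kemeny P1 - kemeny P2 - 2^-1|
        <= real_complex R (eps * norm_fro (Z *m Z) * norm_fro E + C * eps ^+ 2)].
Proof.
move=> P P1 P2 Z sP iP E1 _ _ h1.
have P_1 : P *m const_mx 1 = const_mx 1 :> 'cV_(n1 + n2) by case: sP.
have uA := unitmx_fundamental sP iP h1.
have [d [C [d0 C0 dC]]] := mxtrace_invmx_perturb E uA.
exists C, d; split=> // e ed; have [uAe trAe] := dC e ed; have /andP[e0 _] := ed.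
have Pe_1 : (P + e *: E) *m const_mx 1 = const_mx 1 :> 'cV_(n1 + n2).
  by rewrite mulmxDl -scalemxAl E1 scaler0 addr0.
have AeE : 1%:M - (P + e *: E) + const_mx 1 *m h^T
    = 1%:M - P + const_mx 1 *m h^T - e *: E.
  by rewrite opprD addrA [LHS]addrAC.
have kP : kemeny P = kemeny P1 + kemeny P2 + 2^-1.
  have [q Eq] := factor_theorem _ _ (root_char_poly_row_sum P_1 h1).
  rewrite mulrC in Eq; apply: (kemeny_antidiag Eq).
  (* Invertibility of the fundamental matrix makes 1 a simple root. *)
  by rewrite (horner1_deflated P_1 h1 Eq) -unitfE -unitmxE.
have -> : kemeny (P + e *: E) - kemeny P1 - kemeny P2 - 2^-1
    = kemeny (P + e *: E) - kemeny P by rewrite kP; ring.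
rewrite !(kemeny_mxtrace _ h1) ?AeE // -rmorphB /= -/Z.
(* The difference is real, so the complex modulus is a real absolute value. *)
rewrite normc_def /= expr0n addr0 sqrtr_sqr lecR opprB addrA subrK.
rewrite -/Z in trAe; have trZ : \tr (Z *m E *m Z) = \tr (Z *m Z *m E).
  by rewrite mxtrace_mulC mulmxA.
(* Splits the trace difference into the first-order term and the remainder bounded by [trAe]. *)
rewrite -(subrK (e * \tr (Z *m E *m Z)) (_ - _)) addrC (le_trans (ler_normD _ _)) //.
rewrite lerD // normrM gtr0_norm // -mulrA ler_wpM2l ?(ltW e0) // trZ.
exact: mxtrace_le_norm_fro.
Qed.
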